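(* Let $H$ act irreducibly on a finite-dimensional complex vector space $V$, either as a compact group acting unitarily or as a complex reductive group acting rationally. Then $$1 \leq \mathsf{C}(V) \leq 2 + \ln \dim V.$$
   Context: For a group $H$ with a linear representation $\rho$ on a finite-dimensional complex vector space $V$ and a nonzero subspace $U \leq V$, the group-additive diameter is $$\mathrm{diam}_+^{H}(V,U) = \min\{ m \mid \rho(g_1)\cdot U + \dots + \rho(g_m)\cdot U = V \text{ for some } g_1,\dots,g_m \in H\}.$$ If $H$ acts irreducibly on $V$, the covering ratio of $(V,U)$ is $\mathsf{R}(V,U) = \mathrm{diam}_+^{H}(V,U) / \lceil \dim V/\dim U\rceil$, and the covering complexity of $V$ (with respect to $H$) is $\mathsf{C}(V) = \max_{0 \neq U \leq V} \mathsf{R}(V,U)$. Representations of compact groups are continuous; a complex reductive group is a complex reductive linear algebraic group. *)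

(* Defs.v *)
From HB Require Import structures.
From mathcomp Require Import all_boot all_order all_algebra.
From mathcomp Require Import complex.
From mathcomp Require Import all_classical all_reals all_analysis.
(* Not imported: the notations of mpoly clash with those of analysis. *)
From mathcomp Require mpoly.

Set Implicit Arguments.
Unset Strict Implicit.
Unset Printing Implicit Defensive.

Import Order.TTheory GRing.Theory Num.Theory.
Import numFieldNormedType.Exports.

Local Open Scope classical_set_scope.
Local Open Scope complex_scope.
Local Open Scope ring_scope.

HB.mixin Record Group_isTopologicalGroup H of Group H & Topological H := {
  mulg_continuous : continuous (fun x : H * H => (x.1 * x.2)%g) ;
  invg_continuous : continuous (fun x : H => x^-1%g)
}.

#[short(type="topologicalGroupType")]
HB.structure Definition TopologicalGroup :=
  {H of Group H & Topological H & Group_isTopologicalGroup H}.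

Definition is_representation (K : fieldType) (V : vectType K) (H : groupType)
    (rho : H -> 'End(V)) : Prop :=
  rho 1%g = \1%VF /\ forall g h, rho (g * h)%g = (rho g \o rho h)%VF.

Definition is_irreducible (K : fieldType) (V : vectType K) (H : groupType)
    (rho : H -> 'End(V)) : Prop :=
  fullv != 0%VS :> {vspace V} /\
  forall U : {vspace V}, (forall h, (rho h @: U <= U)%VS) ->
    U = 0%VS \/ U = fullv.

Definition rep_coef (K : fieldType) (V : vectType K) (H : groupType)
    (rho : H -> 'End(V)) (i j : 'I_(\dim {:V})) (h : H) : K :=
  coord (vbasis {:V}) i (rho h (vbasis {:V})`_j).

(* [R[i]^o] is [R[i]] with the topology of the complex modulus. *)
Definition is_continuous_rep (R : realType) (V : vectType R[i])
    (H : topologicalGroupType) (rho : H -> 'End(V)) : Prop :=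
  forall i j, continuous (rep_coef rho i j : H -> R[i]^o).

Definition is_unitary_rep (R : realType) (V : vectType R[i]) (H : groupType)
    (rho : H -> 'End(V)) : Prop :=
  exists dot : {dot V for Num.conj},
    forall h u v, dot (rho h u) (rho h v) = dot u v.

Definition mx_eval (K : fieldType) (N : nat) (A : 'M[K]_N)
    (p : mpoly.mpoly (N * N) K) : K :=
  mpoly.meval (fun k => mxvec A 0 k) p.

(* A linear algebraic group is an abstract group [H] together with an
   isomorphism [iota] onto a Zariski-closed subgroup of GL_N(K). *)
Definition is_linear_algebraic_group (K : fieldType) (H : groupType) (N : nat)
    (iota : H -> 'M[K]_N) : Prop :=
  [/\ injective iota,
      iota 1%g = 1%:M,
      forall g h, iota (g * h)%g = iota g *m iota h &
      exists P : set (mpoly.mpoly (N * N) K),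
        range iota =
        [set A | A \in unitmx /\ forall p, P p -> mx_eval A p = 0]].

Definition zariski_closed (K : fieldType) (H : groupType) (N : nat)
    (iota : H -> 'M[K]_N) (Z : set H) : Prop :=
  exists P : set (mpoly.mpoly (N * N) K),
    Z = [set h | forall p, P p -> mx_eval (iota h) p = 0].

Definition zariski_connected (K : fieldType) (H : groupType) (N : nat)
    (iota : H -> 'M[K]_N) (S : set H) : Prop :=
  forall Z1 Z2 : set H, zariski_closed iota Z1 -> zariski_closed iota Z2 ->
    S `<=` Z1 `|` Z2 -> S `&` Z1 `&` Z2 = set0 ->
    S `<=` Z1 \/ S `<=` Z2.

Definition is_normal_subgroup (H : groupType) (S : set H) : Prop :=
  [/\ S 1%g,
      forall x y, S x -> S y -> S (x * y)%g,
      forall x, S x -> S x^-1%g &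
      forall g x, S x -> S (g * x * g^-1)%g].

Definition is_unipotent (K : fieldType) (N : nat) (A : 'M[K]_N) : Prop :=
  exists k : nat, (A - 1) ^+ k = 0.

(* The unipotent radical, i.e. the largest closed connected normal unipotent
   subgroup, is trivial; the group itself need not be connected. *)
Definition is_reductive_group (K : fieldType) (H : groupType) (N : nat)
    (iota : H -> 'M[K]_N) : Prop :=
  is_linear_algebraic_group iota /\
  forall S : set H, is_normal_subgroup S -> zariski_closed iota S ->
    zariski_connected iota S -> (forall x, S x -> is_unipotent (iota x)) ->
    S = [set 1%g].

(* The regular functions on a closed subgroup of GL_N are the polynomials in
   the matrix entries and the inverse of the determinant. *)
Definition is_regular_function (K : fieldType) (H : groupType) (N : nat)
    (iota : H -> 'M[K]_N) (f : H -> K) : Prop :=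
  exists (p : mpoly.mpoly (N * N) K) (k : nat),
    forall h, f h = mx_eval (iota h) p / \det (iota h) ^+ k.

Definition is_rational_rep (K : fieldType) (V : vectType K) (H : groupType)
    (N : nat) (iota : H -> 'M[K]_N) (rho : H -> 'End(V)) : Prop :=
  forall i j, is_regular_function iota (rep_coef rho i j).

Definition covering_numbers (K : fieldType) (V : vectType K) (H : groupType)
    (rho : H -> 'End(V)) (U : {vspace V}) : set nat :=
  [set m | exists g : 'I_m -> H,
     (\sum_(i < m) rho (g i) @: U)%VS = fullv].

(* The diameter, the covering ratio and the covering complexity are given by
   their graphs, since the minimum and the maximum need not exist for an
   arbitrary [rho]. *)
Definition is_diam (K : fieldType) (V : vectType K) (H : groupType)
    (rho : H -> 'End(V)) (U : {vspace V}) (m : nat) : Prop :=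
  covering_numbers rho U m /\
  forall k, covering_numbers rho U k -> (m <= k)%N.

Definition is_covering_ratio (R : realType) (V : vectType R[i])
    (H : groupType) (rho : H -> 'End(V)) (U : {vspace V}) (r : R) : Prop :=
  exists2 m : nat, is_diam rho U m &
    r = m%:R / (Num.ceil ((\dim {:V})%:R / (\dim U)%:R : R))%:~R.

Definition is_covering_complexity (R : realType) (V : vectType R[i])
    (H : groupType) (rho : H -> 'End(V)) (c : R) : Prop :=
  (exists2 U : {vspace V}, U != 0%VS & is_covering_ratio rho U c) /\
  forall U : {vspace V}, U != 0%VS ->
    exists2 r : R, is_covering_ratio rho U r & r <= c.

(* Main.v *)
Require Import Defs.
From HB Require Import structures.
From mathcomp Require Import all_boot all_order all_algebra.
From mathcomp Require Import complex.
From mathcomp Require Import all_classical all_reals all_analysis.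
From mathcomp Require Import perm zify lra.

Set Implicit Arguments.
Unset Strict Implicit.
Unset Printing Implicit Defensive.

Import Order.TTheory GRing.Theory Num.Theory.
Import numFieldNormedType.Exports.

Local Open Scope classical_set_scope.
Local Open Scope complex_scope.
Local Open Scope ring_scope.

(** Write n = dim V and u = dim U.  The heart of the matter is that for every
    subspace W some g in H satisfies
      n * dim (U :&: gW) <= u * dim W   ([exists_small_intersection]).
    Applied with g^-1, it lets one enlarge a partial sum W of translates of U
    so that its codimension is multiplied by at most 1 - u/n
    ([greedy_step]).  After t = (n/u) ln u + 1 such steps, rounded down, the
    codimension is at most n/u; each further step lowers it by at least one,
    so at most (n/u)(1 + ln u) + 1 translates suffice.  Dividing by the ceiling
    of n/u gives 2 + ln u.  Counting dimensions gives the lower bound 1, and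
    the maximum over U exists because diameters and dimensions only take
    finitely many values.

    To find g one would like to average dim (U :&: gW) over H.  Here this is
    done algebraically.  The sets of those g for which dim (U :&: gX) >= k
    generate a notion of closed subset of H with the descending chain
    condition, since each of them is cut out by linear conditions on the
    products of at most n entries of the matrix of g ([meets_linear]).  Hence
    H is the union of finitely many irreducible components
    ([components_finite]), which right translations permute.  On an irreducible component, two conditions
    that fail somewhere fail simultaneously at some point, so the minimal value
    of dim (U :&: gX) is a supermodular function of X; the sum f of these
    functions over the components is supermodular and invariant under H.  The
    subspaces X maximizing f(X) - (f(V)/n) dim X are closed under sums, so the
    largest of them is invariant under H, hence is 0 or V by irreducibility,
    and the maximum is 0
    ([invariant_supermodular_slope]).  Thus n f(W) <= f(V) dim W; as f(V) is u
    times the number of components, some component satisfies the required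
    inequality. *)

(** * Irreducible components for a family of basic closed sets *)

Section IrreducibleComponents.
Variables (T : Type) (B : set (set T)).

(** The intersections of basic sets, without naming the subfamily. *)
Definition closed_in (C : set T) :=
  forall t, ~ C t -> exists A, [/\ B A, C `<=` A & ~ A t].

(** A finite union of closed sets need not be closed here, so irreducibility has to
    quantify over all finite covers rather than over covers by two sets.  The
    empty cover makes irreducible sets nonempty. *)
Definition irreducible_in (C : set T) :=
  closed_in C /\
  forall s : seq (set T), (forall A, A \in s -> closed_in A) ->
    (forall t, C t -> exists2 A, A \in s & A t) ->
    exists2 A, A \in s & C `<=` A.

Definition component_in (C : set T) :=
  irreducible_in C /\ forall D, irreducible_in D -> C `<=` D -> C = D.

Lemma closed_inI C D : closed_in C -> closed_in D -> closed_in (C `&` D).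
Proof.
move=> cC cD t /not_andP[/cC|/cD] [A [BA sA At]]; exists A; split=> // u [Cu Du];
  exact: sA.
Qed.

Lemma irreducible_in_nonempty C : irreducible_in C -> exists t, C t.
Proof.
move=> [_ irrC]; apply: contrapT => C0.
have [//|t Ct|A //] := irrC [::]; by case: C0; exists t.
Qed.

(** Two dense open subsets of an irreducible set meet. *)
Lemma irreducible_in_avoid C D E : irreducible_in C ->
  closed_in D -> closed_in E -> ~ C `<=` D -> ~ C `<=` E ->
  exists t, [/\ C t, ~ D t & ~ E t].
Proof.
move=> [_ irrC] cD cE CD CE; apply: contrapT => noT.
have cDE A : A \in [:: D; E] -> closed_in A by rewrite !inE => /orP[]/eqP->.
have [t Ct|A] := irrC _ cDE.
  have [Dt|Dt] := pselect (D t); first by exists D; rewrite ?inE ?eqxx.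
  exists E; first by rewrite !inE eqxx orbT.
  by apply: contrapT => Et; apply: noT; exists t.
by rewrite !inE => /orP[]/eqP->.
Qed.

Variables (K : fieldType) (N : nat) (phi : T -> 'rV[K]_N).
Hypothesis basic_linear : forall A t, B A -> ~ A t ->
  exists2 c : 'cV[K]_N, phi t *m c != 0 & forall s, A s -> phi s *m c = 0.

(** Noetherian induction on the rank of a linear space L containing the image
    of C under phi.  If C is not irreducible, it is covered by closed sets A not
    containing it; a basic set that contains A but misses a point of C supplies
    a linear form c that is nonzero on L and vanishes on the image of A, so
    the image of their intersection lies in a smaller space. *)
Lemma closed_in_irreducible_cover C : closed_in C ->
  exists s : seq (set T), (forall A, A \in s -> irreducible_in A) /\
    forall t, C t -> exists2 A, A \in s & A t.
Proof.
suff H : forall d (L : 'M[K]_N) C, (\rank L < d)%N -> closed_in C ->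
    (forall t, C t -> (phi t <= L)%MS) ->
    exists s : seq (set T), (forall A, A \in s -> irreducible_in A) /\
      forall t, C t -> exists2 A, A \in s & A t.
  move=> cC; apply: (H N.+1 1%:M) => //; first by rewrite mxrank1.
  by move=> t _; apply: submx1.
elim=> // {C}d IHd L C rL cC CL.
have [irrC|] := pselect (irreducible_in C).
  exists [:: C]; split=> [A|t Ct]; first by rewrite inE => /eqP->.
  by exists C; rewrite ?inE.
rewrite /irreducible_in => /not_andP[//|/existsNP[s /not_implyP[cs]]].
move=> /not_implyP[Cs noA].
have {noA} noA A : A \in s -> exists t, C t /\ ~ A t.
  move=> As; apply: contrapT => noT; apply: noA; exists A => // t Ct.
  by apply: contrapT => At; apply: noT; exists t.
have cover A : A \in s -> exists u : seq (set T),
    (forall D, D \in u -> irreducible_in D) /\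
    forall t, (C `&` A) t -> exists2 D, D \in u & D t.
  move=> As; have [t [Ct At]] := noA _ As.
  have [D [BD AD Dt]] := cs _ As _ At.
  have [c ct cD] := basic_linear BD Dt.
  apply: (IHd (L :&: kermx c)%MS); last 2 first.
  - exact: closed_inI (cs _ As).
  - move=> x [Cx Ax]; rewrite sub_capmx CL //=.
    by apply/sub_kermxP/cD/AD.
  have LcL : (L :&: kermx c < L)%MS.
    rewrite ltmxE capmxSl /=; apply: contra ct => LLc.
    apply/eqP/sub_kermxP; apply: submx_trans (CL _ Ct) _.
    exact: submx_trans LLc (capmxSr _ _).
  by move: LcL; rewrite ltmxErank => /andP[_ /leq_trans->].
have {cover} : exists u : seq (set T),
    (forall D, D \in u -> irreducible_in D) /\
    forall A t, A \in s -> C t -> A t -> exists2 D, D \in u & D t.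
  elim: s {cs Cs noA} cover => [|A s IHs] cover.
    by exists [::]; split=> // A t; rewrite in_nil.
  have [A' As|u [iu uP]] := IHs _; first by apply: cover; rewrite inE As orbT.
  have [v [iv vP]] := cover A (mem_head _ _).
  exists (v ++ u); split=> [D|A' t]; first by rewrite mem_cat => /orP[/iv|/iu].
  rewrite inE => /orP[/eqP->|A's] Ct At.
    by have [D Dv Dt] := vP t (conj Ct At); exists D; rewrite // mem_cat Dv.
  by have [D Du Dt] := uP _ _ A's Ct At; exists D; rewrite // mem_cat Du orbT.
move=> [u [iu uP]]; exists u; split=> // t Ct.
by have [A As At] := Cs _ Ct; apply: uP As Ct At.
Qed.

(** A cover by irreducible closed sets of minimal length has no redundant
    member, and this forces its members to be maximal. *)
Lemma components_finite (t0 : T) : exists s : seq (set T),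
  [/\ s != [::], uniq s & forall C, (C \in s) <-> component_in C].
Proof.
pose covers (s : seq (set T)) := (forall A, A \in s -> irreducible_in A) /\
  forall t, exists2 A, A \in s & A t.
have exP : exists m, `[< exists2 s, covers s & size s = m >].
  have [|s [is_ sP]] := closed_in_irreducible_cover (C := setT).
    by move=> t /(_ I).
  by exists (size s); apply/asboolP; exists s => //; split=> // t; apply: sP.
have [_ /asboolP[s [is_ sP] <-] smin] := ex_minnP exP.
have small A : A \in s -> ~ exists2 D, D \in rem A s & A `<=` D.
  move=> As [D Ds AD].
  suff : (size s <= size (rem A s))%N.
    by rewrite size_rem //; case: (s) As => //= ? ? _; rewrite ltnn.
  apply: smin; apply/asboolP; exists (rem A s) => //; split.
    by move=> E /mem_rem; apply: is_.
  move=> t; have [E Es Et] := sP t; have [EA|EA] := eqVneq E A.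
    by exists D => //; apply: AD; rewrite -EA.
  exists E => //; move: Es.
  by rewrite (perm_mem (perm_to_rem As)) inE (negPf EA).
have inS C : irreducible_in C -> exists2 A, A \in s & C `<=` A.
  by move=> [_]; apply=> [A /is_[]//|t _]; apply: sP.
exists s; split.
- by case: (s) sP => // /(_ t0)[].
- have rem_uniq A : A \in s -> A \notin rem A s.
    by move=> As; apply/negP => Ar; apply: (small A As); exists A.
  rewrite count_mem_uniq // => A.
  have [As|As] := boolP (A \in s); last by rewrite (count_memPn As).
  rewrite (seq.permP (perm_to_rem As)) /= eqxx; congr addn.
  exact/count_memPn/rem_uniq.
move=> C; split=> [Cs|[iC Cmax]].
  split=> [|D iD CD]; first exact: is_.
  have [A As DA] := inS _ iD.
  suff CA : C = A by apply/seteqP; split=> //; rewrite [X in _ `<=` X]CA.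
  apply: contrapT => /eqP CA; apply: (small C Cs).
  exists A; last exact: subset_trans DA.
  by move: As; rewrite (perm_mem (perm_to_rem Cs)) inE eq_sym (negPf CA).
have [A As CA] := inS _ iC.
by rewrite (Cmax _ (is_ _ As) CA).
Qed.

End IrreducibleComponents.

(** * Invariant supermodular functions on subspaces *)

Section Slope.
Variables (K : fieldType) (V : vectType K) (H : groupType) (rho : H -> 'End(V)).
Hypothesis irr : is_irreducible rho.
Local Notation n := (\dim {:V}).

(** This is the argument for the semistability of an irreducible
    representation: among the subspaces X maximizing n f(X) - f(V) dim X the
    largest one is unique, hence invariant. *)
Lemma invariant_supermodular_slope (f : {vspace V} -> nat) :
  (forall h X, \dim (rho h @: X) = \dim X) ->
  (forall h X, f (rho h @: X)%VS = f X) ->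
  (forall X Y, (f X + f Y <= f (X + Y)%VS + f (X :&: Y)%VS)%N) ->
  f 0%VS = 0%N -> (forall X, f X <= f fullv)%N ->
  forall X, (n * f X <= f fullv * \dim X)%N.
Proof.
move=> rho_dim fH fD f0 ffull X0.
have dimn (X : {vspace V}) : (\dim X <= n)%N by rewrite dimvS ?subvf.
(* Lexicographic maximization: first n f(X) - f(V) dim X, shifted by n f(V)
   to stay in nat, then dim X, which is smaller than the base n.+1. *)
pose psi X := ((n * f X + f fullv * (n - \dim X)) * n.+1 + \dim X)%N.
have psiD X Y : (psi X + psi Y <= psi (X + Y)%VS + psi (X :&: Y)%VS)%N.
  have D := dimv_sum_cap X Y.
  have e1 : (f fullv * (n - \dim X) + f fullv * (n - \dim Y) =
      f fullv * (n - \dim (X + Y)) + f fullv * (n - \dim (X :&: Y)))%N.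
    rewrite -!mulnDr; congr (_ * _)%N.
    move: D (dimn X) (dimn Y) (dimn (X + Y)%VS).
    by move: (dimn (X :&: Y)%VS); lia.
  have e2 : (n * f X + n * f Y <= n * f (X + Y)%VS + n * f (X :&: Y)%VS)%N.
    by rewrite -!mulnDr leq_mul.
  rewrite /psi [leqLHS]addnACA [leqRHS]addnACA -!mulnDl D leq_add2r leq_mul2r.
  by rewrite orFb [leqLHS]addnACA [leqRHS]addnACA e1 leq_add2r.
have exP : exists k, `[< exists X, psi X = k >].
  by exists (psi 0%VS); apply/asboolP; exists 0%VS.
have bdP k : `[< exists X, psi X = k >] ->
    (k <= (n * f fullv + f fullv * n) * n.+1 + n)%N.
  move=> /asboolP[X <-]; rewrite /psi leq_add ?leq_mul ?leq_add //.
  - by rewrite leq_mul2l ffull orbT.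
  - by rewrite leq_mul2l leq_subr orbT.
have [M /asboolP[X XM] Mmax] := ex_maxnP exP bdP.
have {Mmax} Mmax Y : (psi Y <= psi X)%N.
  by rewrite XM; apply: Mmax; apply/asboolP; exists Y.
have Xstable h : (rho h @: X <= X)%VS.
  have E : psi (rho h @: X)%VS = psi X by rewrite /psi rho_dim fH.
  have S1 := Mmax (rho h @: X + X)%VS.
  have S2 := Mmax (rho h @: X :&: X)%VS.
  have {S1 S2 E} E : psi (rho h @: X + X)%VS = psi X.
    by have := psiD (rho h @: X)%VS X; rewrite E; lia.
  (* The dimension is the last digit of psi in base n.+1. *)
  have /(congr1 (fun k => k %% n.+1)%N) := E.
  rewrite /psi !modnMDl !modn_small ?ltnS // => D.
  have : (X == rho h @: X + X)%VS by rewrite eqEdim addvSr /= D.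
  by move=> /eqP {2}->; apply: addvSl.
have psi0 : psi X = (f fullv * n * n.+1 + \dim X)%N.
  have [] := irr.2 _ Xstable => ->; rewrite /psi.
    by rewrite f0 dimv0 subn0 muln0.
  by rewrite subnn muln0 addn0 [(n * f _)%N]mulnC.
rewrite leqNgt; apply/negP => lt_slope.
have lt_M : (f fullv * n < n * f X0 + f fullv * (n - \dim X0))%N.
  by rewrite -{1}(subnKC (dimn X0)) mulnDr ltn_add2r.
have := Mmax X0; rewrite psi0 leqNgt => /negP[].
apply: leq_trans (leq_addr _ _); apply: leq_trans (leq_mul lt_M (leqnn n.+1)).
by rewrite mulSn addnC ltn_add2r ltnS.
Qed.

End Slope.

(** * Sets of group elements defined by large intersections *)

Section Monomials.
Variables (K : comNzRingType) (O : finType) (n : nat).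

Definition word (k : 'I_#|{ffun 'I_n -> O}|) : {ffun 'I_n -> O} := enum_val k.

(** The values at x of all noncommutative monomials of degree n: the n-th
    tensor power of x. *)
Definition monomials (x : O -> K) : 'rV[K]_#|{ffun 'I_n -> O}| :=
  \row_k \prod_i x (word k i).

(** The determinant of a matrix of linear forms in x is a form of degree n,
    hence linear in [monomials x]. *)
Lemma det_monomials (c : 'I_n -> 'I_n -> O -> K) :
  exists w : 'cV[K]_#|{ffun 'I_n -> O}|, forall x : O -> K,
    (monomials x *m w) = (\det (\matrix_(i, j) \sum_o c i j o * x o))%:M.
Proof.
exists (\col_k \sum_(s : 'S_n) (-1) ^+ s * \prod_i c i (s i) (word k i)) => x.
apply/matrixP=> a b; rewrite !ord1 [RHS]mxE eqxx mulr1n mxE.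
transitivity (\sum_(f : {ffun 'I_n -> O}) (\prod_i x (f i)) *
    \sum_(s : 'S_n) (-1) ^+ s * \prod_i c i (s i) (f i)).
  rewrite [RHS](reindex word) /=; first by apply: eq_bigr => k _; rewrite !mxE.
  by apply: onW_bij; exists enum_rank; [exact: enum_valK | exact: enum_rankK].
under eq_bigr do rewrite mulr_sumr.
rewrite exchange_big; apply: eq_bigr => s _ /=.
under [in RHS]eq_bigr do rewrite mxE.
rewrite bigA_distr_bigA mulr_sumr; apply: eq_bigr => f _ /=.
by rewrite big_split /= mulrC mulrA.
Qed.

End Monomials.

Section Intersections.
Variables (K : fieldType) (V : vectType K) (H : groupType) (rho : H -> 'End(V)).
Hypothesis rep : is_representation rho.
Local Notation n := (\dim {:V}).
Local Notation e := (vbasis {:V}).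

Lemma rep_imgM g h (X : {vspace V}) :
  (rho (g * h)%g @: X = rho g @: (rho h @: X))%VS.
Proof. by rewrite rep.2 limg_comp. Qed.

Lemma rep_img1 (X : {vspace V}) : (rho 1%g @: X = X)%VS.
Proof. by rewrite rep.1 lim1g. Qed.

Lemma rep_lker g : lker (rho g) == 0%VS.
Proof.
apply/lker0P => u v /(congr1 (rho g^-1%g)).
by rewrite -!comp_lfunE -rep.2 mulVg rep.1 !id_lfunE.
Qed.

Lemma rep_dim g (X : {vspace V}) : \dim (rho g @: X) = \dim X.
Proof. by rewrite limg_dim_eq // (eqP (rep_lker g)) capv0. Qed.

Lemma limg_full_of_det (f : 'End(V)) :
  \det (passmx.mxof e e f) != 0 -> limg f = fullv.
Proof.
have eb := vbasisP {:V}.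
move=> df; have uf : passmx.mxof e e f \in unitmx by rewrite unitmxE unitfE.
apply/eqP; rewrite eqEsubv subvf /=; apply/subvP => v _.
rewrite -[v](passmx.rVofK eb) -[passmx.rVof _ _](mulmxKV uf).
by rewrite -passmx.hom_vecof // memv_img ?memvf.
Qed.

Variable U : {vspace V}.

Definition meets (X : {vspace V}) (k : nat) : set H :=
  [set g | (k <= \dim (U :&: rho g @: X))%N].

Definition meets_family : set (set H) := [set A | exists X k, A = meets X k].

(** Choose D complementary to tX + U and put E = U + D.  Then tX + E = V, so the
    identity splits as t a + d with a taking values in X and d in E.  If
    dim (U :&: gX) >= k, then dim (gX + U) < dim (tX + U), so gX + E, which
    contains the image of g a + d, is not V. *)
Lemma meets_separation X k t : ~ meets X k t ->
  exists a d : 'End(V), (rho t \o a + d = \1)%VF /\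
    forall g, meets X k g -> limg (rho g \o a + d)%VF != fullv.
Proof.
rewrite /meets /= => /negP; rewrite -ltnNge => tk.
pose D := (rho t @: X + U)^C%VS; pose E := (U + D)%VS.
have XE : (rho t @: X + E)%VS = fullv by rewrite /E addvA addv_complf.
exists (rho t^-1%g \o addv_pi1 (rho t @: X) E)%VF, (addv_pi2 (rho t @: X) E).
split.
  rewrite comp_lfunA -rep.2 mulgV rep.1 comp_lfun1l.
  apply/lfunP => v; rewrite add_lfunE id_lfunE addv_pi1_pi2 //.
  by rewrite XE memvf.
move=> g gk.
set F := (X in limg X).
suff : (\dim (limg F) < n)%N by apply: contraTneq => ->; rewrite ltnn.
have sub : (limg F <= (rho g @: X + U) + D)%VS.
  apply/subvP => _ /memv_imgP[v _ ->].
  rewrite add_lfunE !comp_lfunE -addvA memv_add ?memv_pi2 // memv_img //.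
  have /memv_imgP[x Xx ->] := memv_pi1 (rho t @: X) E v.
  by rewrite -comp_lfunE -rep.2 mulVg rep.1 id_lfunE.
apply: leq_ltn_trans (dimvS sub) _.
apply: leq_ltn_trans (dimv_add_leqif _ _) _.
have := dimv_sum_cap (rho g @: X) U; have := dimv_sum_cap (rho t @: X) U.
have := dimvS (subvf (rho t @: X + U)).
rewrite dimv_compl !rep_dim ![(_ :&: U)%VS]capvC.
move: gk tk; rewrite dimvf; lia.
Qed.

(** The extra value 1 makes affine functions of the matrix of g into linear
    functions of [coefs g]. *)
Definition coefs (g : H) (o : ('I_n * 'I_n + unit)%type) : K :=
  if o is inl p then passmx.mxof e e (rho g) p.1 p.2 else 1.

(** The linear form is g |-> det (g a + d), with a and d given by
    [meets_separation]. *)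
Lemma meets_linear A t : meets_family A -> ~ A t ->
  exists2 c : 'cV[K]_#|{ffun 'I_n -> ('I_n * 'I_n + unit)%type}|,
    monomials n (coefs t) *m c != 0 &
    forall s, A s -> monomials n (coefs s) *m c = 0.
Proof.
move=> [X [k ->]] /meets_separation[a [d [tad gad]]].
have eb := vbasisP {:V}.
pose a' := passmx.mxof e e a; pose d' := passmx.mxof e e d.
pose c (i j : 'I_n) (o : ('I_n * 'I_n + unit)%type) : K :=
  if o is inl p then a' i p.1 * (p.2 == j)%:R else d' i j.
have [w wP] := det_monomials c.
have {wP} wP g : monomials n (coefs g) *m w =
    (\det (passmx.mxof e e (rho g \o a + d)%VF))%:M.
  rewrite wP -[(_ \o a)%VF]scale1r passmx.mxof_linear scale1r.
  rewrite (passmx.mxof_comp _ _ eb) -/a' -/d'; congr (\det _)%:M.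
  apply/matrixP => i j.
  rewrite [LHS]mxE [RHS]mxE [(_ *m _) i j]mxE big_sumType /=.
  congr (_ + _); last first.
    by rewrite (bigD1 tt) //= big1 => [|[]//]; rewrite mulr1 addr0.
  rewrite (eq_bigr (fun p => a' i p.1 * (p.2 == j)%:R *
     passmx.mxof e e (rho g) p.1 p.2)) //.
  rewrite -(pair_bigA _ (fun p q => a' i p * (q == j)%:R *
     passmx.mxof e e (rho g) p q)) /=; apply: eq_bigr => p _.
  rewrite (bigD1 j) //= eqxx mulr1 big1 ?addr0 // => q /negPf->.
  by rewrite mulr0 mul0r.
exists w.
  rewrite wP tad passmx.mxof1 ?(basis_free eb) // det1.
  by apply/eqP => /matrixP/(_ 0 0)/eqP; rewrite !mxE eqxx oner_eq0.
move=> s /gad; rewrite wP => /eqP notfull; apply/eqP.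
have [->|ds] := eqVneq (\det (passmx.mxof e e (rho s \o a + d)%VF)) 0.
  by rewrite raddf0.
by case: notfull; apply: limg_full_of_det.
Qed.

End Intersections.

(** * Generic dimension of intersections *)

Section GenericIntersection.
Variables (K : fieldType) (V : vectType K) (H : groupType) (rho : H -> 'End(V)).
Hypothesis rep : is_representation rho.
Variable U : {vspace V}.
Local Notation n := (\dim {:V}).
Local Notation meets := (meets rho U).
Local Notation closed := (closed_in (meets_family rho U)).
Local Notation irreducible := (irreducible_in (meets_family rho U)).
Local Notation component := (component_in (meets_family rho U)).

Definition pullback (h : H) (C : set H) : set H := [set g | C (g * h)%g].

Lemma pullbackK h : cancel (pullback h) (pullback h^-1%g).
Proof. by move=> C; apply/seteqP; split=> g; rewrite /pullback /= mulgVK. Qed.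

Lemma pullbackVK h : cancel (pullback h^-1%g) (pullback h).
Proof. by move=> C; rewrite -{1}[h]invgK pullbackK. Qed.

Lemma pullbackS h C D : C `<=` D -> pullback h C `<=` pullback h D.
Proof. by move=> CD g /CD. Qed.

Lemma meets_img X h k : meets (rho h @: X)%VS k = pullback h (meets X k).
Proof.
by apply/seteqP; split=> g; rewrite /pullback /meets /= rep_imgM.
Qed.

Lemma meets_closed X k : closed (meets X k).
Proof. by move=> g gk; exists (meets X k); split=> //; exists X, k. Qed.

Lemma closed_pullback h C : closed C -> closed (pullback h C).
Proof.
move=> cC g /cC[_ [[X [k ->]] CX gX]]; exists (meets (rho h @: X)%VS k).
split; rewrite meets_img //; last exact: pullbackS.
by exists (rho h @: X)%VS, k; rewrite meets_img.
Qed.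

Lemma irreducible_pullback h C : irreducible C -> irreducible (pullback h C).
Proof.
move=> [cC irrC]; split=> [|s cs Cs]; first exact: closed_pullback.
have [_ /mapP[A As ->] CA|t Ct|_ /mapP[A As ->] CA] :=
    irrC [seq pullback h^-1%g A | A <- s].
- exact/closed_pullback/cs.
- have [|A As At] := Cs (t * h^-1)%g; first by rewrite /pullback /= mulgVK.
  by exists (pullback h^-1%g A) => //; apply: map_f.
by exists A; rewrite // -[A](pullbackVK h); apply: pullbackS.
Qed.

Lemma component_pullback h C : component C -> component (pullback h C).
Proof.
move=> [iC maxC]; split=> [|D iD CD]; first exact: irreducible_pullback.
rewrite -[D](pullbackVK h); congr (pullback h _).
apply: maxC; first exact: irreducible_pullback.
by rewrite -[C](pullbackK h); apply: pullbackS.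
Qed.

(** For nonempty C, the minimum of dim (U :&: gX) over g in C, which on an
    irreducible set is also the generic value. *)
Definition generic_dim (C : set H) (X : {vspace V}) : nat :=
  \max_(k < n.+1 | `[< C `<=` meets X k >]) k.

Lemma generic_dim_le C X : C `<=` meets X (generic_dim C X).
Proof.
rewrite /generic_dim; apply: (big_ind (fun k => C `<=` meets X k)).
- by move=> g _; rewrite /meets /=.
- by move=> k l Ck Cl; case: (leqP k l).
- by move=> k /asboolP.
Qed.

Lemma generic_dim_max C X : (exists g, C g) ->
  ~ C `<=` meets X (generic_dim C X).+1.
Proof.
move=> [g Cg] CX; have lt_n : ((generic_dim C X).+1 < n.+1)%N.
  by rewrite ltnS; apply: leq_trans (CX _ Cg) _; rewrite dimvS ?subvf.
suff : ((generic_dim C X).+1 <= generic_dim C X)%N by rewrite ltnn.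
rewrite {2}/generic_dim -[X in (X <= _)%N]/(nat_of_ord (Ordinal lt_n)).
by rewrite leq_bigmax_cond //=; apply/asboolP.
Qed.

Lemma generic_dim_eq C X m : (exists g, C g) ->
  (forall g, \dim (U :&: rho g @: X) = m) -> generic_dim C X = m.
Proof.
move=> C0 dm; apply/eqP; rewrite eqn_leq; apply/andP; split.
  by have [g Cg] := C0; have := generic_dim_le X Cg; rewrite /meets /= dm.
rewrite leqNgt; apply/negP => lt_m; apply: (generic_dim_max C0 (X := X)) => g _.
by rewrite /meets /= dm.
Qed.

(** At a point g of C where both dimensions on the right take their generic
    value, this is the supermodularity of X |-> dim (U :&: gX). *)
Lemma generic_dim_supermodular C X Y : irreducible C ->
  (generic_dim C X + generic_dim C Y <=
   generic_dim C (X + Y)%VS + generic_dim C (X :&: Y)%VS)%N.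
Proof.
move=> iC; have C0 := irreducible_in_nonempty iC.
have [g [Cg]] := irreducible_in_avoid iC
  (@meets_closed _ _) (@meets_closed _ _)
  (generic_dim_max C0 (X := (X + Y)%VS))
  (generic_dim_max C0 (X := (X :&: Y)%VS)).
rewrite /meets /= => /negP; rewrite -ltnNge ltnS => gS.
move=> /negP; rewrite -ltnNge ltnS => gI.
apply: leq_trans (leq_add gS gI).
apply: leq_trans (leq_add (generic_dim_le X Cg) (generic_dim_le Y Cg)) _.
rewrite -dimv_sum_cap limgD lker0_img_cap ?rep_lker // leq_add // dimvS //.
  by rewrite subv_cap subv_add !capvSl /= addvS // capvSr.
by apply/subvP => v; rewrite !memv_cap => /andP[/andP[-> ->] /andP[_ ->]].
Qed.

Lemma generic_dim_img C X h :
  generic_dim C (rho h @: X)%VS = generic_dim (pullback h^-1%g C) X.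
Proof.
apply: eq_bigl => k; apply/asbool_equiv_eq; rewrite meets_img; split.
  by move=> CX; rewrite -[meets X k](pullbackK h); apply: pullbackS.
by move=> CX; rewrite -[C](pullbackVK h); apply: pullbackS.
Qed.

(** Averaging over the components of H replaces averaging over H: the sum of
    the generic dimensions over all components is invariant under H because
    translations permute the components. *)
Theorem exists_small_intersection (X : {vspace V}) : is_irreducible rho ->
  exists g, (n * \dim (U :&: rho g @: X) <= \dim U * \dim X)%N.
Proof.
move=> irr.
have [s [s0 us sP]] := components_finite (meets_linear rep (U := U)) (1%g : H).
pose f X := (\sum_(C <- s) generic_dim C X)%N.
have irrs C : C \in s -> irreducible C by move=> /sP[].
have sum_const (g : set H -> nat) m :
    (forall C, C \in s -> g C = m) -> (\sum_(C <- s) g C = size s * m)%N.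
  by move=> gm; rewrite (eq_big_seq _ gm) big_const_seq count_predT iter_addn_0
    mulnC.
have ffull : f fullv = (size s * \dim U)%N.
  apply: sum_const => C /irrs/irreducible_in_nonempty C0.
  apply: generic_dim_eq => // g.
  have -> : (rho g @: fullv)%VS = fullv.
    by apply/eqP; rewrite eqEdim subvf (rep_dim rep) leqnn.
  by rewrite capvf.
have slope : (n * f X <= f fullv * \dim X)%N.
  apply: (invariant_supermodular_slope irr) => [h Y|h Y|Y Z||Y].
  - exact: rep_dim.
  - rewrite /f (eq_bigr _ (fun C _ => generic_dim_img C Y h)).
    rewrite -(big_map (pullback h^-1%g) predT (fun C => generic_dim C Y)).
    apply: perm_big; apply: uniq_perm => //.
      by rewrite map_inj_uniq //; apply: can_inj (pullbackVK h).
    move=> C; apply/mapP/idP => [[D Ds ->]|Cs].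
      by apply/sP/component_pullback/sP.
    exists (pullback h C); last by rewrite pullbackK.
    by apply/sP/component_pullback/sP.
  - rewrite /f -!big_split /= !big_seq leq_sum // => C Cs.
    exact: generic_dim_supermodular (irrs _ Cs).
  - rewrite /f (sum_const _ 0%N) ?muln0 // => C /irrs/irreducible_in_nonempty C0.
    by apply: generic_dim_eq => // g; rewrite limg0 capv0 dimv0.
  rewrite ffull /f -(sum_const (fun=> \dim U) (\dim U)) //.
  rewrite !big_seq leq_sum // => C /irrs/irreducible_in_nonempty[g Cg].
  by apply: leq_trans (generic_dim_le Y Cg) _; rewrite dimvS ?capvSl.
have [C Cs small] : exists2 C, C \in s &
    (n * generic_dim C X <= \dim U * \dim X)%N.
  apply: contrapT => nosmall; move: slope; rewrite ffull leqNgt => /negP[].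
  rewrite /f big_distrr /= -mulnA.
  apply: (@leq_trans (size s * (\dim U * \dim X).+1)%N).
    by rewrite ltn_pmul2l // lt0n size_eq0.
  rewrite -(sum_const (fun=> (\dim U * \dim X).+1) _ (fun _ _ => erefl)).
  rewrite !big_seq leq_sum // => C Cs; rewrite ltnNge; apply/negP => CX.
  by apply: nosmall; exists C.
have /existsNP[g /not_implyP[Cg]] := generic_dim_max (X := X)
  (irreducible_in_nonempty (irrs _ Cs)).
rewrite /meets /= => /negP; rewrite -ltnNge ltnS => gX; exists g.
by apply: leq_trans small; rewrite leq_mul.
Qed.

End GenericIntersection.

(** * The greedy covering *)

Section GreedyCovering.
Variables (K : fieldType) (V : vectType K) (H : groupType) (rho : H -> 'End(V)).
Hypothesis rep : is_representation rho.
Hypothesis irr : is_irreducible rho.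
Variable U : {vspace V}.
Local Notation n := (\dim {:V}).
Local Notation u := (\dim U).

Lemma dim_fullv_gt0 : (0 < n)%N.
Proof. by rewrite lt0n dimv_eq0 irr.1. Qed.

(** Since W :&: g^-1 U and gW :&: U have the same dimension. *)
Lemma greedy_step (W : {vspace V}) : exists g,
  (n * (n - \dim (W + rho g @: U)) <= (n - u) * (n - \dim W))%N.
Proof.
have [g gW] := exists_small_intersection rep U W irr.
exists g^-1%g.
have cap : \dim (W :&: rho g^-1%g @: U) = \dim (U :&: rho g @: W).
  rewrite -(rep_dim rep g) lker0_img_cap ?rep_lker // -(rep_imgM rep) mulgV.
  by rewrite (rep_img1 rep) capvC.
have := dimv_sum_cap W (rho g^-1%g @: U); rewrite cap (rep_dim rep).
have := dimvS (subvf W); have := dimvS (subvf U).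
have := dimvS (subvf (W + rho g^-1%g @: U)).
move: gW; set c := \dim (U :&: _); set S := \dim (_ + _); set w := \dim W.
move=> gW /subnKC Sn /subnKC un /subnKC wn.
rewrite -{1}Sn; move: gW Sn un wn.
move: (n - S)%N (n - u)%N (n - w)%N => a b d.
nia.
Qed.

Lemma greedy_iter t : exists2 s : seq H, size s = t &
  (n ^ t * (n - \dim (\sum_(g <- s) rho g @: U)) <= (n - u) ^ t * n)%N.
Proof.
elim: t => [|t [s st IH]].
  by exists [::]; rewrite // big_nil dimv0 subn0.
have [g gs] := greedy_step (\sum_(g <- s) rho g @: U).
exists (g :: s); first by rewrite /= st.
rewrite big_cons addvC !expnSr -mulnA; apply: leq_trans (leq_mul (leqnn _) gs) _.
by rewrite mulnCA [(_ ^ t * _)%N in leqRHS]mulnC -[leqRHS]mulnA leq_mul.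
Qed.

Hypothesis U0 : U != 0%VS.

(** While the codimension is positive, [greedy_step] lowers it by at least
    one, because u > 0. *)
Lemma greedy_finish c (W : {vspace V}) : (n - \dim W <= c)%N ->
  exists2 s : seq H, size s = c & (W + \sum_(g <- s) rho g @: U)%VS = fullv.
Proof.
have u0 : (0 < u)%N by rewrite lt0n dimv_eq0.
have un := dimvS (subvf U).
elim: c W => [|c IH] W Wc.
  exists [::]; rewrite // big_nil addv0; apply/eqP.
  by rewrite eqEdim subvf -subn_eq0 -leqn0.
have [g gW] := greedy_step W.
have [|s sc sW] := IH (W + rho g @: U)%VS.
  have := dim_fullv_gt0; move: Wc gW un u0.
  move: (n - \dim W)%N (n - \dim (W + rho g @: U))%N => a b ac.
  case: a ac => [|a] ac; first by nia.
  move=> ab un u0 n0; suff : (b < a.+1)%N by lia.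
  rewrite -(ltn_pmul2l n0); apply: leq_ltn_trans ab _.
  by rewrite ltn_pmul2r //; lia.
by exists (g :: s); rewrite /= ?sc // big_cons addvA.
Qed.

Lemma covering_numbers_size (s : seq H) :
  (\sum_(g <- s) rho g @: U)%VS = fullv -> covering_numbers rho U (size s).
Proof. by move=> sU; exists (tnth (in_tuple s)); rewrite -sU [RHS]big_tnth. Qed.

Lemma covering_number_lower m : covering_numbers rho U m -> (n <= m * u)%N.
Proof.
move=> [g gU]; rewrite -gU.
apply: leq_trans
  (dimv_leq_sum (index_enum _) predT (fun i => rho (g i) @: U)%VS) _.
rewrite (eq_bigr (fun=> u)) => [|i _]; last exact: rep_dim.
by rewrite sum_nat_const card_ord.
Qed.

(** Any bound c on the codimension that [greedy_iter] guarantees after t steps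
    gives a cover by t + c translates. *)
Lemma greedy_covering t c :
  (forall d, n ^ t * d <= (n - u) ^ t * n -> d <= c)%N ->
  exists2 m, covering_numbers rho U m & (m <= t + c)%N.
Proof.
move=> tc; have [s st gs] := greedy_iter t.
have [s' <- sU] := greedy_finish (tc _ gs).
exists (size s + size s')%N; last by rewrite st.
rewrite -size_cat.
by apply: covering_numbers_size; rewrite big_cat.
Qed.

Lemma covering_le_dim : exists2 m, covering_numbers rho U m & (m <= n)%N.
Proof.
by apply: (greedy_covering (t := 0) (c := n)) => d; rewrite !expn0 !mul1n.
Qed.

Lemma exists_diam : exists m, is_diam rho U m.
Proof.
have [m mU _] := covering_le_dim.
have exP : exists m, `[< covering_numbers rho U m >] by exists m; apply/asboolP.
have [d /asboolP dU dmin] := ex_minnP exP.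
by exists d; split=> // k kU; apply: dmin; apply/asboolP.
Qed.

Lemma diam_le_dim m : is_diam rho U m -> (m <= n)%N.
Proof.
move=> [_ mmin]; have [k kU] := covering_le_dim.
by apply: leq_trans; apply: mmin.
Qed.

End GreedyCovering.

(** * The covering complexity *)

Section Complexity.
Variables (R : realType) (V : vectType R[i]) (H : groupType).
Variable rho : H -> 'End(V).
Hypothesis rep : is_representation rho.
Hypothesis irr : is_irreducible rho.
Local Notation n := (\dim {:V}).

Definition ratio (m u : nat) : R :=
  m%:R / (Num.ceil (n%:R / u%:R : R))%:~R.

Lemma ratio_ge1 U m : U != 0%VS -> is_diam rho U m -> 1 <= ratio m (\dim U).
Proof.
move=> U0 [/(covering_number_lower rep) nm _].
have u0 : (0 : R) < (\dim U)%:R by rewrite ltr0n lt0n dimv_eq0.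
have n0 : (0 : R) < n%:R by rewrite ltr0n (dim_fullv_gt0 irr).
rewrite /ratio ler_pdivlMr ?ltr0z ?ceil_gt0 ?divr_gt0 // mul1r.
rewrite -[m%:R]/((m : int)%:~R) ler_int ceil_le_int ler_pdivrMr //.
by rewrite -[X in _ <= X * _]/(m%:R) -natrM ler_nat.
Qed.

(** With x = n/u, take t just above x ln u.  As (1 - 1/x)^t <= exp (- t/x) <=
    1/u, the codimension after t greedy steps is at most x, so the diameter is
    at most t + x <= x ln u + 1 + x. *)
Lemma ratio_le U m : U != 0%VS -> is_diam rho U m ->
  ratio m (\dim U) <= 2 + ln n%:R.
Proof.
move=> U0 [_ mmin].
have u0 : (0 : R) < (\dim U)%:R by rewrite ltr0n lt0n dimv_eq0.
have n0 : (0 : R) < n%:R by rewrite ltr0n (dim_fullv_gt0 irr).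
have un : (\dim U <= n)%N by rewrite dimvS ?subvf.
have unR : (\dim U)%:R <= (n%:R : R) by rewrite ler_nat.
set x : R := n%:R / (\dim U)%:R; set y : R := x * ln (\dim U)%:R.
have x1 : 1 <= x by rewrite ler_pdivlMr // mul1r.
have x0 : 0 < x by apply: lt_le_trans x1.
have lnu0 : 0 <= ln (\dim U)%:R :> R by rewrite ln_ge0 // ler1n lt0n dimv_eq0.
have y0 : 0 <= y by rewrite mulr_ge0 // ltW.
have /andP[ty yt] := truncn_itv y0.
set t := (Num.truncn y).+1 in yt.
have /andP[cx xc] := truncn_itv (ltW x0).
set c := Num.truncn x in cx xc.
have [d|k kU ktc] := greedy_covering rep irr U0 (t := t) (c := c).
  rewrite -(@ler_nat R) natrM natrX natrM natrX natrB // => dt.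
  suff dx : (d%:R : R) <= x by rewrite -ltnS -(@ltr_nat R) (le_lt_trans dx).
  have nt : (0 : R) < n%:R ^+ t by rewrite exprn_gt0.
  have le1 : (d%:R : R) <= (1 - x^-1) ^+ t * n%:R.
    rewrite -(ler_pM2l nt); apply: le_trans dt _.
    by rewrite mulrA -exprMn mulrBr mulr1 invf_div mulrCA divff ?mulr1 ?gt_eqF.
  apply: (le_trans le1).
  have x'1 : 0 <= 1 - x^-1 by rewrite subr_ge0 invf_le1.
  have le2 : (1 - x^-1) ^+ t <= expR (- ln (\dim U)%:R).
    apply: (@le_trans _ _ (expR (- x^-1) ^+ t)).
      by rewrite lerXn2r ?nnegrE ?expR_ge0 ?expR_ge1Dx.
    rewrite -expRM_natl ler_expR mulrN lerN2.
    by rewrite ler_pdivlMr // mulrC ltW.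
  rewrite /x mulrC ler_pM2l //.
  by apply: (le_trans le2); rewrite expRN lnK.
set q : R := (Num.ceil x)%:~R.
have xq : x <= q by apply: ceil_ge.
have q0 : 0 < q by apply: lt_le_trans xq.
have q1 : 1 <= q by apply: le_trans xq.
rewrite /ratio -/x -/q ler_pdivrMr //.
have mk : (m%:R : R) <= t%:R + c%:R.
  by rewrite -natrD ler_nat (leq_trans _ ktc) ?mmin.
have ln_le : ln (\dim U)%:R <= ln (n%:R : R) by rewrite ler_ln ?posrE.
apply: (le_trans mk).
have : (t%:R : R) <= y + 1 by rewrite /t -natr1 lerD2r.
have : y <= q * ln n%:R by rewrite /y ler_pM // ltW.
nra.
Qed.

(** The pair (diameter, dim U) ranges over a finite set, so some U maximizes
    the covering ratio. *)
Theorem covering_complexity_bounds : exists C : R,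
  is_covering_complexity rho C /\ 1 <= C <= 2 + ln n%:R.
Proof.
pose P (p : 'I_n.+1 * 'I_n.+1) := `[< exists2 U : {vspace V}, U != 0%VS &
  is_diam rho U p.1 /\ \dim U = p.2 >].
pose F (p : 'I_n.+1 * 'I_n.+1) : R := ratio p.1 p.2.
have dimP U m : U != 0%VS -> is_diam rho U m ->
    exists2 p, P p & F p = ratio m (\dim U).
  move=> U0 mU; have mn := diam_le_dim rep irr U0 mU.
  have un : (\dim U <= n)%N by rewrite dimvS ?subvf.
  exists (Ordinal (mn : (m < n.+1)%N), Ordinal (un : (\dim U < n.+1)%N)) => //.
  by apply/asboolP; exists U.
have [m mV] := exists_diam rep irr irr.1.
have [p0 Pp0 _] := dimP _ _ irr.1 mV.
case: (@Order.TotalTheory.arg_maxP _ _ _ p0 P F Pp0) => p.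
move=> /asboolP[U U0 [mU uU]] Fmax.
exists (F p); split; last first.
  by rewrite /F -uU ratio_ge1 // ratio_le.
split; first by exists U => //; exists p.1 => //; rewrite /F -uU.
move=> W W0; have [k kW] := exists_diam rep irr W0.
exists (ratio k (\dim W)); first by exists k.
by have [q Pq <-] := dimP _ _ W0 kW; apply: Fmax.
Qed.

End Complexity.

Theorem proposition3p7 (R : realType) (V : vectType R[i]) :
  (forall (H : topologicalGroupType) (rho : H -> 'End(V)),
     compact [set: H] ->
     is_representation rho -> is_continuous_rep rho -> is_unitary_rep rho ->
     is_irreducible rho ->
     exists C : R, is_covering_complexity rho C /\
       1 <= C <= 2 + ln (\dim {:V})%:R) /\
  (forall (H : groupType) (N : nat) (iota : H -> 'M[R[i]]_N)
       (rho : H -> 'End(V)),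
     is_reductive_group iota ->
     is_representation rho -> is_rational_rep iota rho ->
     is_irreducible rho ->
     exists C : R, is_covering_complexity rho C /\
       1 <= C <= 2 + ln (\dim {:V})%:R).

Proof.
split=> [H rho _ rep _ _ irr|H N iota rho _ rep _ irr];
  exact: covering_complexity_bounds rep irr.
Qed.
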